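(* Let $H$ be a non-cyclic two-generated $\aleph_0$-monoid. Then $H$ cannot be realized simultaneously to both a PDFG and a non-PDFG ring; that is, there do not exist a PDFG ring $R$ and a ring $S$ which is not PDFG such that $H\cong V^{\aleph_0}(R)$ and $H\cong V^{\aleph_0}(S)$ as $\aleph_0$-monoids.
   Context: Write $\aleph_0=\{0,1,2,\dots\}$. An $\aleph_0$-monoid is a set $H$ with an element $0\in H$ and a map $\Sigma\colon H^{\aleph_0}\to H$, written $\sum_{i\in\aleph_0}x_i := \Sigma((x_i)_{i})$, such that (A1) if $x_i=0$ for all $i\neq 0$ then $\sum_{i\in\aleph_0} x_i=x_0$; (A2) for every $(x_{i,j})\in H^{\aleph_0\times\aleph_0}$ and every bijection $\pi\colon\aleph_0\times\aleph_0\to\aleph_0$, $\sum_{i}\sum_{j} x_{i,j}=\sum_{k}x_{\pi^{-1}(k)}$. Finite sums are defined by padding with zeros; in particular $H$ becomes a commutative reduced monoid. An isomorphism of $\aleph_0$-monoids is a bijection preserving $0$ and $\Sigma$. $\langle X\rangle_{\aleph_0}$ is the smallest $\aleph_0$-submonoid containing $X$ (subset containing $0$ and closed under $\Sigma$). $H$ is cyclic if $H=\langle x\rangle_{\aleph_0}$ for some $x\in H$, and two-generated if $H=\langle\{x_1,x_2\}\rangle_{\aleph_0}$ for some $x_1,x_2\in H$. Rings are associative and unital. For a ring $R$, $V^{\aleph_0}(R)$ is the $\aleph_0$-monoid of isomorphism classes $[P]$ of countably generated projective right $R$-modules, with $\sum_i [P_i]=[\bigoplus_i P_i]$. A ring is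 PDFG if every projective right module is a direct sum of finitely generated modules. *)

(* Defs.v *)
From HB Require Import structures.
From mathcomp Require Import all_boot all_algebra.
From mathcomp Require Import boolp classical_sets functions cardinality.

Set Implicit Arguments.
Unset Strict Implicit.
Unset Printing Implicit Defensive.

Import GRing.Theory.
Local Open Scope ring_scope.

HB.mixin Record isAleph0Monoid (H : Type) := {
  azero : H;
  asum : (nat -> H) -> H;
  asum_head : forall x : nat -> H,
    (forall i, i <> 0%N -> x i = azero) -> asum x = x 0%N;
  asum_asum : forall (x : nat -> nat -> H) (p : nat * nat -> nat)
      (pinv : nat -> nat * nat), cancel p pinv -> cancel pinv p ->
    asum (fun i => asum (fun j => x i j))
    = asum (fun k => x (pinv k).1 (pinv k).2)
}.

#[short(type="aleph0Monoid")]
HB.structure Definition Aleph0Monoid := {H of isAleph0Monoid H}.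

(* Subsets of H are plain predicates rather than [set H]: the carrier of
   [Vmonoid] below is too large for the universe of [set]. *)
Definition aleph0_submonoid (H : aleph0Monoid) (A : H -> Prop) : Prop :=
  A azero /\ forall x : nat -> H, (forall i, A (x i)) -> A (asum x).

Definition aleph0_generated (H : aleph0Monoid) (X : H -> Prop) : H -> Prop :=
  fun y => forall A : H -> Prop,
    aleph0_submonoid A -> (forall x, X x -> A x) -> A y.

Definition aleph0_cyclic (H : aleph0Monoid) : Prop :=
  exists x : H, forall y : H, aleph0_generated (fun z => z = x) y.

Definition aleph0_two_generated (H : aleph0Monoid) : Prop :=
  exists x1 x2 : H, forall y : H,
    aleph0_generated (fun z => z = x1 \/ z = x2) y.

Definition aleph0_isomorphic (H K : aleph0Monoid) : Prop :=
  exists f : H -> K,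
    [/\ bijective f, f azero = azero
      & forall x : nat -> H, f (asum x) = asum (fun i => f (x i))].

Definition mod_isomorphic (R : pzRingType) (M N : lmodType R) : Prop :=
  exists f : {linear M -> N}, bijective f.

Definition is_submodule (R : pzRingType) (M : lmodType R) (A : set M) : Prop :=
  A 0 /\ forall (a : R) (u v : M), A u -> A v -> A (a *: u + v).

Definition mod_generates (R : pzRingType) (M : lmodType R) (X : set M) : Prop :=
  smallest (@is_submodule R M) X = [set: M]%classic.

Definition finitely_generated (R : pzRingType) (M : lmodType R) : Prop :=
  exists X : set M, finite_set X /\ mod_generates X.

Definition countably_generated (R : pzRingType) (M : lmodType R) : Prop :=
  exists X : set M, countable X /\ mod_generates X.

Definition projective (R : pzRingType) (P : lmodType R) : Prop :=
  forall (A B : lmodType R) (g : {linear A -> B}) (f : {linear P -> B}),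
    (forall b : B, exists a : A, g a = b) ->
    exists h : {linear P -> A}, forall x : P, g (h x) = f x.

Record dsum (R : pzRingType) (I : Type) (F : I -> lmodType R) := DSum {
  dsum_fun :> forall i, F i;
  dsum_finite : finite_set [set i | dsum_fun i != 0]%classic
}.

Section DSumModule.
Variables (R : pzRingType) (I : Type) (F : I -> lmodType R).
Implicit Types x y z : dsum F.

Lemma dsum_ext x y : (forall i, x i = y i) -> x = y.
Proof.
case: x y => [x hx] [y hy] /= exy.
have e : x = y by apply: functional_extensionality_dep.
by case: _ / e hy => hy; congr DSum; exact: Prop_irrelevance.
Qed.

HB.instance Definition _ := gen_eqMixin (dsum F).
HB.instance Definition _ := gen_choiceMixin (dsum F).

Fact dsum_zero_finite : finite_set [set i | (0 : F i) != 0]%classic.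
Proof. by apply: (sub_finite_set _ (finite_set0 I)) => i /=; rewrite eqxx. Qed.

Fact dsum_add_finite x y : finite_set [set i | x i + y i != 0]%classic.
Proof.
apply: (@sub_finite_set _ _ ([set i | x i != 0] `|` [set i | y i != 0])%classic).
  move=> i /= h; have [x0|] := eqVneq (x i) 0; last by left.
  by right; move: h; rewrite x0 add0r.
by rewrite finite_setU; split; apply: dsum_finite.
Qed.

Fact dsum_opp_finite x : finite_set [set i | - x i != 0]%classic.
Proof.
by apply: sub_finite_set (dsum_finite x) => i /=; rewrite oppr_eq0.
Qed.

Fact dsum_scale_finite a x : finite_set [set i | a *: x i != 0]%classic.
Proof.
apply: sub_finite_set (dsum_finite x) => i /=.
by apply: contra_neq => ->; rewrite scaler0.
Qed.

Definition dsum_zero : dsum F := DSum dsum_zero_finite.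
Definition dsum_add x y : dsum F := DSum (dsum_add_finite x y).
Definition dsum_opp x : dsum F := DSum (dsum_opp_finite x).
Definition dsum_scale a x : dsum F := DSum (dsum_scale_finite a x).

Fact dsum_addA : associative dsum_add.
Proof. by move=> x y z; apply: dsum_ext => i /=; rewrite addrA. Qed.
Fact dsum_addC : commutative dsum_add.
Proof. by move=> x y; apply: dsum_ext => i /=; rewrite addrC. Qed.
Fact dsum_add0 : left_id dsum_zero dsum_add.
Proof. by move=> x; apply: dsum_ext => i /=; rewrite add0r. Qed.
Fact dsum_addN : left_inverse dsum_zero dsum_opp dsum_add.
Proof. by move=> x; apply: dsum_ext => i /=; rewrite addNr. Qed.

HB.instance Definition _ :=
  GRing.isZmodule.Build (dsum F) dsum_addA dsum_addC dsum_add0 dsum_addN.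

Fact dsum_scaleA a b x : dsum_scale a (dsum_scale b x) = dsum_scale (a * b) x.
Proof. by apply: dsum_ext => i /=; rewrite scalerA. Qed.
Fact dsum_scale1 : left_id 1 dsum_scale.
Proof. by move=> x; apply: dsum_ext => i /=; rewrite scale1r. Qed.
Fact dsum_scaleDr : right_distributive dsum_scale +%R.
Proof. by move=> a x y; apply: dsum_ext => i /=; rewrite scalerDr. Qed.
Fact dsum_scaleDl x : {morph dsum_scale^~ x : a b / a + b}.
Proof. by move=> a b; apply: dsum_ext => i /=; rewrite scalerDl. Qed.

HB.instance Definition _ := GRing.Zmodule_isLmodule.Build R (dsum F)
  dsum_scaleA dsum_scale1 dsum_scaleDr dsum_scaleDl.

Lemma dsum0E i : (0 : dsum F) i = 0. Proof. by []. Qed.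
Lemma dsumDE x y i : (x + y) i = x i + y i. Proof. by []. Qed.
Lemma dsumZE a x i : (a *: x) i = a *: x i. Proof. by []. Qed.

End DSumModule.

(* A right R-module is a left module over the converse ring R^c. *)
Definition pdfg (R : pzRingType) : Prop :=
  forall P : lmodType R^c, projective P ->
    exists (I : Type) (F : I -> lmodType R^c),
      (forall i, finitely_generated (F i)) /\ mod_isomorphic P (dsum F).

Section ModuleFacts.
Variable R : pzRingType.

Lemma exists_linear (M N : lmodType R) (f : M -> N) :
  linear f -> exists g : {linear M -> N}, g =1 f.
Proof.
move=> lf; pose h := GRing.isLinear.Build R M N *:%R f lf.
by pose g : {linear M -> N} := HB.pack f h; exists g.
Qed.

Lemma dep_choice (I : Type) (T : I -> Type) (P : forall i, T i -> Prop) :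
  (forall i, exists y, P i y) -> exists f : forall i, T i, forall i, P i (f i).
Proof.
by move=> h; exists (fun i => sval (cid (h i))) => i; apply: (svalP (cid (h i))).
Qed.

Lemma inj_surj_bij (A B : Type) (f : A -> B) :
  injective f -> (forall b, exists a, f a = b) -> bijective f.
Proof.
move=> fi fs; pose g b := sval (cid (fs b)).
have fg b : f (g b) = b by rewrite /g; case: (cid _).
by exists g => // a; apply: fi.
Qed.

Lemma linear_bij_isomorphic (M N : lmodType R) (f : M -> N) :
  linear f -> injective f -> (forall y, exists x, f x = y) ->
  mod_isomorphic M N.
Proof.
move=> /exists_linear[g gf] fi fs; exists g.
apply: inj_surj_bij => [x y|y]; first by rewrite !gf => /fi.
by have [x <-] := fs y; exists x.
Qed.

Lemma mod_isomorphic_refl (M : lmodType R) : mod_isomorphic M M.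
Proof. by apply: (@linear_bij_isomorphic M M id) => // y; exists y. Qed.

Lemma mod_isomorphic_sym (M N : lmodType R) :
  mod_isomorphic M N -> mod_isomorphic N M.
Proof.
case=> f [g fK gK]; apply: (@linear_bij_isomorphic N M g).
- by move=> a u v; apply: (can_inj fK); rewrite linearP !gK.
- exact: can_inj gK.
- by move=> y; exists (f y).
Qed.

Lemma mod_isomorphic_trans (M N P : lmodType R) :
  mod_isomorphic M N -> mod_isomorphic N P -> mod_isomorphic M P.
Proof. by case=> f fb [g gb]; exists (g \o f); apply: bij_comp. Qed.

Lemma dsum_isomorphic (I : Type) (F G : I -> lmodType R) :
  (forall i, mod_isomorphic (F i) (G i)) -> mod_isomorphic (dsum F) (dsum G).
Proof.
move=> FG; have [f fb] := dep_choice FG.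
have fin (x : dsum F) : finite_set [set i | f i (x i) != 0]%classic.
  apply: sub_finite_set (dsum_finite x) => i /=.
  by apply: contra_neq => ->; rewrite linear0.
apply: (@linear_bij_isomorphic _ _ (fun x => DSum (fin x))).
- by move=> a x y; apply: dsum_ext => i; rewrite dsumDE dsumZE /= linearP.
- move=> x y e; apply: dsum_ext => i; apply: (bij_inj (fb i)).
  exact: (congr1 (fun z : dsum G => z i) e).
- move=> y; have /dep_choice[x xy] : forall i, exists z, f i z = y i.
    by move=> i; have [g _ gK] := fb i; exists (g (y i)).
  have xfin : finite_set [set i | x i != 0]%classic.
    apply: sub_finite_set (dsum_finite y) => i /=.
    apply: contra_neq => yi; apply: (bij_inj (fb i)).
    by rewrite xy yi linear0.
  by exists (DSum xfin); apply: dsum_ext => i /=; apply: xy.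
Qed.

Lemma dsum_bound (F : nat -> lmodType R) (x : dsum F) :
  exists n, forall i, (n <= i)%N -> x i = 0.
Proof.
have /finite_seqP[s es] := dsum_finite x.
exists (\max_(i <- s) i).+1 => i hi; apply/eqP; case: eqP => // /eqP xi.
have : [set` s]%classic i by rewrite -es.
by move=> /(@leq_bigmax_seq _ s xpredT id) -/(_ isT); rewrite leqNgt hi.
Qed.

Fact dsum_inj_finite (F : nat -> lmodType R) i (m : F i) :
  finite_set [set j | dfwith (fun j => 0 : F j) m j != 0]%classic.
Proof.
apply: (sub_finite_set _ (finite_set1 i)) => j /=.
by have [e|ij] := eqVneq i j; [move=> _; symmetry | rewrite // dfwith_out // eqxx].
Qed.

Definition dsum_inj (F : nat -> lmodType R) i (m : F i) : dsum F :=
  DSum (dsum_inj_finite m).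

Lemma dsum_inj_linear (F : nat -> lmodType R) i : linear (@dsum_inj F i).
Proof.
move=> a u v; apply: dsum_ext => j; rewrite dsumDE dsumZE /=.
have [<-|ij] := eqVneq i j; first by rewrite !dfwith_in.
by rewrite !dfwith_out // scaler0 addr0.
Qed.

Lemma dsum_sumE (F : nat -> lmodType R) (J : Type) (r : seq J)
    (G : J -> dsum F) i :
  (\sum_(j <- r) G j) i = \sum_(j <- r) G j i.
Proof. by elim/big_rec2: _ => // j _ y _ <-. Qed.

Lemma dsum_decomp (F : nat -> lmodType R) (x : dsum F) n :
  (forall i, (n <= i)%N -> x i = 0) ->
  x = \sum_(i < n) dsum_inj (x i).
Proof.
move=> xn; apply: dsum_ext => j; rewrite dsum_sumE /=.
have [jn|/xn jn] := ltnP j n; last first.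
  rewrite jn big1 // => i _ /=; have [e|ij] := eqVneq (i : nat) j.
    by case: _ / e jn => <-; rewrite dfwith_in.
  by rewrite dfwith_out.
rewrite (bigD1 (Ordinal jn)) //= dfwith_in big1 ?addr0 // => i ij.
by rewrite dfwith_out.
Qed.

Lemma countably_generated_dsum (F : nat -> lmodType R) :
  (forall i, countably_generated (F i)) -> countably_generated (dsum F).
Proof.
move=> /dep_choice[X hX]; exists (\bigcup_i (@dsum_inj F i @` X i))%classic; split.
  apply: bigcup_countable => // i _; have [Xc _] := hX i.
  exact: card_le_trans (card_image_le _ _) Xc.
apply/seteqP; split => // x _ A [[A0 Al] XA].
have [n /dsum_decomp ->] := dsum_bound x.
have AD u v : A u -> A v -> A (u + v).
  by move=> Au Av; rewrite -[u]scale1r; apply: Al.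
elim/big_ind: _ => // i _.
have [_ Xi] := hX i.
have : [set: F i]%classic (x i) by [].
rewrite -Xi => /(_ [set m | A (dsum_inj m)]%classic) /=; apply; split.
  split=> [|a u v Au Av] /=; last by rewrite dsum_inj_linear; apply: Al.
  have /exists_linear[g gE] := @dsum_inj_linear F i.
  by rewrite -gE linear0.
by move=> m Xm; apply: XA; exists i => //; exists m.
Qed.

Lemma projective_dsum (F : nat -> lmodType R) :
  (forall i, projective (F i)) -> projective (dsum F).
Proof.
move=> Fp A B g f gs.
have /dep_choice[h hE] : forall i, exists h : {linear F i -> A},
    forall x, g (h x) = f (dsum_inj x).
  move=> i; have [k kE] := exists_linear (@dsum_inj_linear F i).
  have [h hE] := Fp i _ _ g (f \o k) gs.
  by exists h => x; rewrite hE /= kE.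
pose N x := sval (cid (@dsum_bound F x)).
have NP x i : (N x <= i)%N -> x i = 0.
  by rewrite /N; case: (cid _) => n /= /[apply].
pose H (x : dsum F) := \sum_(i < N x) h i (x i).
have HE (x : dsum F) n : (forall i, (n <= i)%N -> x i = 0) -> H x = \sum_(i < n) h i (x i).
  have key m k : (m <= k)%N -> (forall i, (m <= i)%N -> x i = 0) ->
      \sum_(i < m) h i (x i) = \sum_(i < k) h i (x i).
    move=> mk mx; rewrite -(big_mkord xpredT (fun i => h i (x i))).
    rewrite -(big_mkord xpredT (fun i => h i (x i))) [RHS](big_cat_nat (n := m)) //=.
    rewrite [X in _ + X]big_nat_cond [X in _ + X]big1 ?addr0 //.
    by move=> i /andP[/andP[mi _] _]; rewrite mx ?linear0.
  move=> nx; rewrite /H; case: (leqP (N x) n) => hn.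
    by apply: key => //; apply: NP.
  by apply/esym/key => //; apply: ltnW.
have Hl : linear H.
  move=> a x y; pose n := maxn (N x) (N y).
  have xn i : (n <= i)%N -> x i = 0 by rewrite geq_max => /andP[/NP].
  have yn i : (n <= i)%N -> y i = 0 by rewrite geq_max => /andP[_ /NP].
  rewrite (HE _ _ xn) (HE _ _ yn) (HE _ n); last first.
    by move=> i ni; rewrite dsumDE dsumZE xn // yn // scaler0 addr0.
  rewrite scaler_sumr -big_split /=; apply: eq_bigr => i _.
  exact: linearP.
have [k kE] := exists_linear Hl; exists k => x; rewrite kE.
rewrite [in RHS](dsum_decomp (@NP x)) /H !linear_sum /=.
by apply: eq_bigr => i _; rewrite hE.
Qed.

Lemma dsum_dsum_isomorphic (F : nat -> nat -> lmodType R)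
    (p : nat * nat -> nat) (pinv : nat -> nat * nat) :
  cancel p pinv -> cancel pinv p ->
  mod_isomorphic (dsum (fun i => dsum (F i)))
                 (dsum (fun k => F (pinv k).1 (pinv k).2)).
Proof.
move=> pK pinvK.
have fin (x : dsum (fun i => dsum (F i))) :
    finite_set [set k | x (pinv k).1 (pinv k).2 != 0]%classic.
  apply: (@sub_finite_set _ _
    (\bigcup_(i in [set i | x i != 0%R])
       (fun j => p (i, j)) @` [set j | x i j != 0%R])%classic).
    move=> k /= xk; exists (pinv k).1 => /=.
      by apply: contra_neq xk => ->.
    by exists (pinv k).2 => //; rewrite -surjective_pairing pinvK.
  apply: bigcup_finite => [|i _]; first exact: dsum_finite.
  exact: (finite_image _ (dsum_finite (x i))).
apply: (@linear_bij_isomorphic _ _ (fun x => DSum (fin x))).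
- by move=> a x y; apply: dsum_ext.
- move=> x y e; apply: dsum_ext => i; apply: dsum_ext => j.
  have := congr1 (fun z : dsum _ => z (p (i, j))) e.
  by rewrite /= pK.
- move=> y.
  pose w (q : nat * nat) : F q.1 q.2 := ecast r (F r.1 r.2) (pK q) (y (p q)).
  pose z i j : F i j := w (i, j).
  have zE k : z (pinv k).1 (pinv k).2 = y k.
    have -> : z (pinv k).1 (pinv k).2 = w (pinv k) by rewrite /z; case: (pinv k).
    rewrite /w; move: (p _) (pinvK k) (pK _) => m em.
    by case: _ / em => e; rewrite eq_axiomK.
  have z0 i j : z i j != 0 -> y (p (i, j)) != 0.
    have c0 q r (e : q = r) : ecast s (F s.1 s.2) e (0 : F q.1 q.2) = 0.
      by case: _ / e.
    by apply: contra_neq; rewrite /z /w => ->; exact: (c0 _ _ (pK (i, j))).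
  have yfin := dsum_finite y.
  have zfin i : finite_set [set j | z i j != 0]%classic.
    apply: (sub_finite_set _ (finite_image (fun k => (pinv k).2) yfin)).
    by move=> j /= /z0 ij; exists (p (i, j)); rewrite // pK.
  have zzfin : finite_set [set i | DSum (zfin i) != 0]%classic.
    apply: (sub_finite_set _ (finite_image (fun k => (pinv k).1) yfin)).
    move=> i /= zi; apply: contrapT => ni; move/eqP: zi; apply.
    apply: dsum_ext => j /=; apply/eqP/negPn/negP => /z0 yij.
    by apply: ni; exists (p (i, j)); rewrite // pK.
  by exists (DSum zzfin); apply: dsum_ext => k /=; apply: zE.
Qed.

Lemma dsum_head_isomorphic (F : nat -> lmodType R) :
  (forall i, i <> 0%N -> forall x : F i, x = 0) -> mod_isomorphic (dsum F) (F 0%N).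
Proof.
move=> F0; apply: (@linear_bij_isomorphic _ _ (fun x : dsum F => x 0%N)) => //.
- by move=> x y xy; apply: dsum_ext => -[//|i]; rewrite [LHS]F0 // [RHS]F0.
- by move=> m; exists (dsum_inj m) => /=; rewrite dfwith_in.
Qed.

Lemma projective_zero : projective 'rV[R]_0.
Proof.
move=> A B g f gs; exists \0 => x /=.
by rewrite linear0 thinmx0 linear0.
Qed.

Lemma countably_generated_zero : countably_generated 'rV[R]_0.
Proof.
exists set0; split; first exact: countable0.
by apply/seteqP; split => // x _ A [[A0 _] _]; rewrite thinmx0.
Qed.

End ModuleFacts.

Record cgproj (R : pzRingType) := CGProj {
  cgproj_mod :> lmodType R^c;
  cgproj_countable : countably_generated cgproj_mod;
  cgproj_projective : projective cgproj_mod
}.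

Definition cgproj_zero (R : pzRingType) : cgproj R :=
  CGProj (@countably_generated_zero R^c) (@projective_zero R^c).

Definition cgproj_dsum (R : pzRingType) (P : nat -> cgproj R) : cgproj R :=
  CGProj (countably_generated_dsum (fun i => cgproj_countable (P i)))
         (projective_dsum (fun i => @cgproj_projective R (P i))).

(* An isomorphism class is the predicate on cgproj R that it determines. *)
Definition Vmonoid (R : pzRingType) : Type :=
  {C : cgproj R -> Prop | exists P : cgproj R, C = fun Q => mod_isomorphic P Q}.

Section VMonoid.
Variable R : pzRingType.
Implicit Types (P Q : cgproj R) (c d : Vmonoid R).

Definition Vclass P : Vmonoid R :=
  exist _ (fun Q => mod_isomorphic P Q) (ex_intro _ P erefl).

Definition Vrepr c : cgproj R := sval (cid (svalP c)).

Lemma Vmonoid_ext c d : (forall Q, sval c Q <-> sval d Q) -> c = d.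
Proof.
case: c d => [C hC] [D hD] /= CD; apply: eq_exist.
by apply/funext => Q; apply/propext.
Qed.

Lemma Vclass_eqP P Q : Vclass P = Vclass Q <-> mod_isomorphic P Q.
Proof.
split=> [/(congr1 sval) /= e|PQ].
  by rewrite (congr1 (fun C => C Q) e); apply: mod_isomorphic_refl.
apply: Vmonoid_ext => S /=; split.
  exact/mod_isomorphic_trans/mod_isomorphic_sym.
exact: mod_isomorphic_trans.
Qed.

Lemma VreprK c : Vclass (Vrepr c) = c.
Proof.
by apply: Vmonoid_ext => Q; rewrite /Vrepr; case: (cid _) => P /= ->.
Qed.

Lemma Vrepr_class P : mod_isomorphic (Vrepr (Vclass P)) P.
Proof. by apply/Vclass_eqP; rewrite VreprK. Qed.

Definition Vzero : Vmonoid R := Vclass (cgproj_zero R).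

(* The representatives are arbitrary; see Vsum_class. *)
Definition Vsum (x : nat -> Vmonoid R) : Vmonoid R :=
  Vclass (cgproj_dsum (fun i => Vrepr (x i))).

Lemma Vsum_class (P : nat -> cgproj R) :
  Vsum (fun i => Vclass (P i)) = Vclass (cgproj_dsum P).
Proof.
by apply/Vclass_eqP; apply: dsum_isomorphic => i; apply: Vrepr_class.
Qed.

Fact Vsum_head (x : nat -> Vmonoid R) :
  (forall i, i <> 0%N -> x i = Vzero) -> Vsum x = x 0%N.
Proof.
move=> x0; rewrite -[RHS]VreprK; apply/Vclass_eqP.
apply: (@dsum_head_isomorphic R^c (fun i => Vrepr (x i))) => i /x0 -> y.
have [f [g fK _]] := Vrepr_class (cgproj_zero R).
by apply: (can_inj fK); rewrite [LHS]thinmx0 [RHS]thinmx0.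
Qed.

Fact Vsum_sum (x : nat -> nat -> Vmonoid R) (p : nat * nat -> nat)
    (pinv : nat -> nat * nat) : cancel p pinv -> cancel pinv p ->
  Vsum (fun i => Vsum (fun j => x i j))
  = Vsum (fun k => x (pinv k).1 (pinv k).2).
Proof.
move=> pK pinvK; rewrite [LHS]Vsum_class; apply/Vclass_eqP.
exact: (@dsum_dsum_isomorphic R^c (fun i j => Vrepr (x i j)) _ _ pK pinvK).
Qed.

HB.instance Definition _ :=
  isAleph0Monoid.Build (Vmonoid R) Vsum_head Vsum_sum.

End VMonoid.

(* Main.v *)
Require Import Defs.
From HB Require Import structures.
From mathcomp Require Import all_boot all_algebra.
From mathcomp Require Import boolp classical_sets functions cardinality fsbigop.
From mathcomp Require Import wochoice.

Set Implicit Arguments.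
Unset Strict Implicit.
Unset Printing Implicit Defensive.

Import GRing.Theory.
Local Open Scope ring_scope.

(** Whether a ring is PDFG can be read off from the aleph0-monoid of its
countably generated projective modules, so that isomorphic aleph0-monoids
cannot come from a PDFG ring and a ring that is not PDFG.

The bridge is a notion of compactness. Call c compact if, whenever c is a
summand of a countable sum, it is already a summand of some finite partial sum;
this only mentions the zero and the sum, so isomorphisms preserve it. The class
of a projective module P is compact exactly when P is finitely generated. If P
is finitely generated and splits off from a countable direct sum, finitely many
coordinates contain the image of P, and the splitting survives their truncation
([finitely_generated_compact]). Conversely P splits off from a free module of
countable rank; if its class is compact, P splits off from a free module of
finite rank ([compact_finitely_generated]).

Hence R is PDFG if and only if every element of the monoid is a countable sum of
compact elements ([pdfg_compactly_generated]). For the direct implication, a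
countably generated module that is a direct sum of finitely generated ones has
only countably many nonzero summands ([countable_decomposition]). For the
converse, one must pass from countably generated projective modules to all of
them, which is Kaplansky's theorem that a projective module is a direct sum of
countably generated ones ([kaplansky]). *)

(** * Submodules and generating sets *)

Section Submodules.
Variable R : pzRingType.
Implicit Types M N P : lmodType R.

Definition mod_span M (X : set M) : set M := smallest (@is_submodule R M) X.

Lemma submoduleD M (A : set M) u v : is_submodule A -> A u -> A v -> A (u + v).
Proof. by move=> [_ Al] Au Av; rewrite -[u]scale1r; apply: Al. Qed.

Lemma submoduleB M (A : set M) u v : is_submodule A -> A u -> A v -> A (u - v).
Proof. by move=> [_ Al] Au Av; rewrite addrC -scaleN1r; apply: Al. Qed.

Lemma submodule_sum M (A : set M) (J : eqType) (r : seq J) (G : J -> M) :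
  is_submodule A -> (forall j, j \in r -> A (G j)) -> A (\sum_(j <- r) G j).
Proof.
move=> Asub AG; rewrite big_seq; elim/big_ind: _ => //; first by case: Asub.
by move=> u v; apply: submoduleD.
Qed.

Lemma span_submodule M (X : set M) : is_submodule (mod_span X).
Proof.
split=> [A [[A0 Al] _] //|a u v Xu Xv A AX].
by have [[_ Al] _] := AX; apply: Al; [apply: Xu | apply: Xv].
Qed.

Lemma sub_span M (X : set M) : (X `<=` mod_span X)%classic.
Proof. by move=> x Xx A [_]; apply. Qed.

Lemma span_sub M (X A : set M) :
  is_submodule A -> (X `<=` A)%classic -> (mod_span X `<=` A)%classic.
Proof. by move=> Asub XA x; apply. Qed.

Lemma range_submodule M N (f : {linear M -> N}) : is_submodule (range f).
Proof.
split=> [|a _ _ [x _ <-] [y _ <-]]; first by exists 0; rewrite ?linear0.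
by exists (a *: x + y); rewrite // linearP.
Qed.

Lemma fixed_submodule M N (f g : {linear M -> N}) :
  is_submodule [set x | f x = g x]%classic.
Proof.
split=> [|a u v /= fu fv]; first by rewrite /= !linear0.
by rewrite !linearP fu fv.
Qed.

Lemma preimage_submodule M N (f : {linear M -> N}) (A : set N) :
  is_submodule A -> is_submodule (f @^-1` A)%classic.
Proof.
move=> [A0 Al]; split=> [|a u v Au Av] /=; first by rewrite linear0.
by rewrite linearP; apply: Al.
Qed.

Lemma mod_generates_image M N (f : {linear M -> N}) (X : set M) :
  (forall y, exists x, f x = y) -> mod_generates X -> mod_generates (f @` X)%classic.
Proof.
move=> fs Xgen; apply/seteqP; split=> // y _ A [Asub XA].
have [x <-] := fs y; have : (mod_span X) x by rewrite /mod_span Xgen.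
apply: (span_sub (preimage_submodule f Asub)) => z Xz.
by apply: XA; exists z.
Qed.

Lemma finitely_generated_image M N (f : {linear M -> N}) :
  (forall y, exists x, f x = y) -> finitely_generated M -> finitely_generated N.
Proof.
move=> fs [X [Xfin Xgen]]; exists (f @` X)%classic; split.
  exact: finite_image.
exact: mod_generates_image.
Qed.

Lemma countably_generated_image M N (f : {linear M -> N}) :
  (forall y, exists x, f x = y) -> countably_generated M -> countably_generated N.
Proof.
move=> fs [X [Xc Xgen]]; exists (f @` X)%classic; split.
  exact: card_le_trans (card_image_le _ _) Xc.
exact: mod_generates_image.
Qed.

Lemma finite_countably_generated M : finitely_generated M -> countably_generated M.
Proof. by move=> [X [Xfin Xgen]]; exists X; split=> //; apply: finite_set_countable. Qed.

(** Kaplansky's theorem and complements produce submodules as sets, whereas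
direct sums are formed from modules: an abstract module with an embedding avoids
carrying the subtype around. *)
Lemma submodule_module M (A : set M) : is_submodule A ->
  exists (N : lmodType R) (i : {linear N -> M}), injective i /\ range i = A.
Proof.
move=> [A0 Al]; pose Apred : {pred M} := fun x => `[< A x >].
have Acl : submod_closed Apred.
  by split=> [|a u v /asboolP Au /asboolP Av]; apply/asboolP => //; apply: Al.
pose K : submodClosed M := HB.pack Apred (GRing.isSubmodClosed.Build R M Apred Acl).
pose T := {x : M | x \in K}.
pose N : lmodType R := HB.pack T [SubChoice_isSubLmodule of T by <:].
have [i iE] : exists i : {linear N -> M}, i =1 (fun x : T => val x).
  by apply: exists_linear.
exists N, i; split=> [x y|]; first by rewrite !iE => /val_inj.
apply/seteqP; split=> [_ [x _ <-]|x Ax].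
  by rewrite iE; apply/asboolP; apply: (valP (x : T)).
have xK : x \in K by apply/asboolP.
by exists (exist _ x xK : T); rewrite // iE.
Qed.

(** Generators in the ambient module are enough, since the embedding reflects
the linear combinations that they produce. *)
Lemma countably_generated_submodule M N (i : {linear N -> M}) (X : set M) :
  injective i -> range i = mod_span X -> countable X -> countably_generated N.
Proof.
move=> iinj iX Xc.
have [g gE] : exists g : M -> N, forall x, mod_span X x -> i (g x) = x.
  have /dep_choice[g gE] : forall x, exists y, mod_span X x -> i y = x.
    move=> x; have [|nXx] := pselect (mod_span X x); last by exists 0.
    by rewrite -iX => -[y _ <-]; exists y.
  by exists g.
exists (g @` X)%classic; split; first exact: card_le_trans (card_image_le _ _) Xc.
apply/seteqP; split=> // y _ B [[B0 Bl] XB].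
have Bsub : is_submodule (i @` B)%classic.
  split=> [|a _ _ [u Bu <-] [v Bv <-]]; first by exists 0; rewrite ?linear0.
  by exists (a *: u + v); [apply: Bl | rewrite linearP].
have Xi : (X `<=` i @` B)%classic.
  move=> x Xx; exists (g x); last by apply: gE; apply: sub_span.
  by apply: XB; exists x.
have : range i (i y) by exists y.
by rewrite iX => /(span_sub Bsub Xi)[z Bz /iinj <-].
Qed.

End Submodules.

(** * Direct sums over arbitrary index sets *)

Section DirectSums.
Variables (R : pzRingType) (I : choiceType).
Implicit Types (F G : I -> lmodType R) (M : lmodType R).

Lemma dsum_support F (x : dsum F) :
  exists s : seq I, uniq s /\ forall i, (i \in s) = (x i != 0).
Proof.
have /finite_seqP[s sE] := dsum_finite x.
exists (undup s); split=> [|i]; first exact: undup_uniq.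
rewrite mem_undup; apply/idP/idP => xi; first by have : [set` s]%classic i by []; rewrite -sE.
by have : [set i | x i != 0]%classic i by []; rewrite sE.
Qed.

Fact dsum_in_finite F i (m : F i) :
  finite_set [set j | dfwith (fun j => 0 : F j) m j != 0]%classic.
Proof.
apply: (sub_finite_set _ (finite_set1 i)) => j /=.
by have [e|ij] := eqVneq i j; [move=> _; symmetry | rewrite // dfwith_out // eqxx].
Qed.

Definition dsum_in F i (m : F i) : dsum F := DSum (dsum_in_finite m).

Lemma dsum_in_id F i (m : F i) : dsum_in m i = m.
Proof. exact: dfwith_in. Qed.

Lemma dsum_in_neq F i j (m : F i) : i != j -> dsum_in m j = 0.
Proof. exact: dfwith_out. Qed.

Lemma dsum_in_linear F i : linear (@dsum_in F i).
Proof.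
move=> a u v; apply: dsum_ext => j; rewrite dsumDE dsumZE.
have [<-|ij] := eqVneq i j; first by rewrite !dsum_in_id.
by rewrite !dsum_in_neq // scaler0 addr0.
Qed.

Lemma dsum_inE F (s : seq I) (x : dsum F) :
  uniq s -> (forall i, x i != 0 -> i \in s) -> x = \sum_(i <- s) dsum_in (x i).
Proof.
move=> us xs; apply: dsum_ext => j.
have -> : (\sum_(i <- s) dsum_in (x i)) j = \sum_(i <- s) dsum_in (x i) j.
  by elim/big_rec2: _ => // i _ y _ <-.
have [js|js] := boolP (j \in s).
  rewrite (bigD1_seq j) // dsum_in_id big1 => [|i ij]; first exact/esym/addr0.
  by rewrite dsum_in_neq.
rewrite big_seq big1 => [|i si].
  by apply/eqP; apply: contraNT js; apply: xs.
by rewrite dsum_in_neq //; apply: contraNneq js => <-.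
Qed.

(** Induction principle: membership in a submodule is checked on the elements
supported at one index. *)
Lemma dsum_submodule F (A : set (dsum F)) :
  is_submodule A -> (forall i (m : F i), A (dsum_in m)) -> forall x, A x.
Proof.
move=> Asub Ain x; have [s [us xs]] := dsum_support x.
rewrite (@dsum_inE _ s x) // => [|i]; last by rewrite xs.
by apply: submodule_sum.
Qed.

Lemma dsum_projection F i : exists p : {linear dsum F -> F i}, forall x, p x = x i.
Proof. by apply: (@exists_linear R (dsum F) (F i) (fun x => x i)). Qed.

Lemma dsum_coprojection F i :
  exists u : {linear F i -> dsum F}, forall m, u m = dsum_in m.
Proof. exact: exists_linear (@dsum_in_linear F i). Qed.

Definition dsum_lift F M (u : forall i, {linear F i -> M}) (x : dsum F) : M :=
  \sum_(i \in [set: I]%classic) u i (x i).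

Lemma dsum_liftE F M (u : forall i, {linear F i -> M}) (s : seq I) (x : dsum F) :
  uniq s -> (forall i, x i != 0 -> i \in s) ->
  dsum_lift u x = \sum_(i <- s) u i (x i).
Proof.
move=> us xs; rewrite /dsum_lift (fsbigE s) // => [|i _ si].
  by apply: eq_bigl => i; apply/asboolP.
by have [->|/xs] := eqVneq (x i) 0; [apply: linear0 | rewrite (negPf si)].
Qed.

Lemma dsum_lift_linear F M (u : forall i, {linear F i -> M}) :
  linear (dsum_lift u).
Proof.
move=> a x y; have [s [_ xs]] := dsum_support x; have [t [_ yt]] := dsum_support y.
have us := undup_uniq (s ++ t).
have cover (z : dsum F) : (forall i, z i != 0 -> (x i != 0) || (y i != 0)) ->
    forall i, z i != 0 -> i \in undup (s ++ t).
  by move=> xyz i /xyz; rewrite mem_undup mem_cat xs yt.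
rewrite !(@dsum_liftE _ _ u (undup (s ++ t))) //; last 3 first.
- by apply: cover => i ->; rewrite orbT.
- by apply: cover => i ->.
- apply: cover => i; rewrite dsumDE dsumZE; apply: contraR.
  by rewrite negb_or !negbK => /andP[/eqP-> /eqP->]; rewrite scaler0 addr0.
rewrite scaler_sumr -big_split; apply: eq_bigr => i _.
exact: linearP.
Qed.

Lemma dsum_lift_in F M (u : forall i, {linear F i -> M}) i (m : F i) :
  dsum_lift u (dsum_in m) = u i m.
Proof.
rewrite (@dsum_liftE _ _ u [:: i]) // ?big_seq1 ?dsum_in_id // => j.
by rewrite inE; apply: contraR => ij; rewrite dsum_in_neq // eq_sym.
Qed.

Lemma eq_dsum_lift F M (u v : forall i, {linear F i -> M}) (x : dsum F) :
  (forall i, u i (x i) = v i (x i)) -> dsum_lift u x = dsum_lift v x.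
Proof. by move=> uv; apply: eq_fsbigr => i _; apply: uv. Qed.

Lemma dsum_lift_submodule F M (u : forall i, {linear F i -> M}) (A : set M) (x : dsum F) :
  is_submodule A -> (forall i, A (u i (x i))) -> A (dsum_lift u x).
Proof.
move=> Asub uA; have [s [us xs]] := dsum_support x.
rewrite (@dsum_liftE _ _ u s) // => [|i]; last by rewrite xs.
exact: submodule_sum.
Qed.

Lemma dsum_map F G (f : forall i, {linear F i -> G i}) :
  exists h : {linear dsum F -> dsum G}, forall x i, h x i = f i (x i).
Proof.
have fin (x : dsum F) : finite_set [set i | f i (x i) != 0]%classic.
  apply: sub_finite_set (dsum_finite x) => i /=.
  by apply: contra_neq => ->; rewrite linear0.
have [|h hE] := @exists_linear R _ _ (fun x => DSum (fin x) : dsum G).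
  by move=> a x y; apply: dsum_ext => i; rewrite dsumDE dsumZE /= linearP.
by exists h => x i; rewrite hE.
Qed.

(** All isomorphisms with direct sums that start from a family of coordinate
functions come from this criterion. The last condition, on elements with a single
nonzero coordinate, replaces a choice of embeddings of the summands: it only has
to hold elementwise. *)
Lemma dsum_recognition F M (p : forall i, {linear M -> F i}) :
  (forall x, finite_set [set i | p i x != 0]%classic) ->
  (forall x, (forall i, p i x = 0) -> x = 0) ->
  (forall i (m : F i), exists x, p i x = m /\ forall j, i != j -> p j x = 0) ->
  mod_isomorphic M (dsum F).
Proof.
move=> pfin pinj psurj; pose f x : dsum F := DSum (pfin x).
have fl : linear f by move=> a x y; apply: dsum_ext => i; rewrite /= linearP.
have [g gE] := exists_linear fl.
apply: (linear_bij_isomorphic fl) => [x y xy|].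
  apply/eqP; rewrite -subr_eq0; apply/eqP/pinj => i; rewrite linearB.
  by apply/eqP; rewrite subr_eq0; apply/eqP/(congr1 (fun z : dsum F => z i) xy).
suff: forall y, range g y by move=> gs y; have [x _ <-] := gs y; exists x; rewrite gE.
apply: dsum_submodule => [|i m]; first exact: range_submodule.
have [x [xm x0]] := psurj i m; exists x => //; rewrite gE; apply: dsum_ext => j.
have [<-|ij] := eqVneq i j; first by rewrite dsum_in_id.
by rewrite dsum_in_neq // /f /= x0.
Qed.

End DirectSums.

(** * Kaplansky's theorem on projective modules *)

Section Kaplansky.
Variables (R : pzRingType) (P : lmodType R).

(** Split the canonical surjection onto P from the free module on all elements of
P: the b-th coordinate of h is the functional dual to the generator b. Indexing by P
itself keeps every later construction inside P. *)
Lemma projective_dual_basis : projective P ->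
  exists h : {linear P -> dsum (fun _ : P => R^o)},
    forall u : P -> {linear R^o -> P}, (forall b a, u b a = (a : R) *: b) ->
    forall x, dsum_lift u (h x) = x.
Proof.
move=> Pproj.
have /dep_choice[u uE] : forall b : P, exists u : {linear R^o -> P},
    forall a, u a = (a : R) *: b.
  move=> b; apply: (@exists_linear R R^o P (fun a => (a : R) *: b)) => a x y.
  by rewrite scalerDl scalerA.
have [g gE] := exists_linear (dsum_lift_linear u).
have [|h hE] := Pproj _ _ g idfun.
  move=> b; exists (@dsum_in R P (fun _ => R^o) b 1).
  by rewrite gE dsum_lift_in uE scale1r.
exists h => v vE x; rewrite -[RHS](hE x) gE.
by apply: eq_dsum_lift => b; rewrite uE vE.
Qed.

Variable h : {linear P -> dsum (fun _ : P => R^o)}.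
Hypothesis hP : forall u : P -> {linear R^o -> P}, (forall b a, u b a = (a : R) *: b) ->
    forall x, dsum_lift u (h x) = x.

(** What is needed for truncating dual-basis expansions to T to give a
projection of P onto the span of T. *)
Definition coordinate_closed (T : set P) : Prop :=
  forall t b, T t -> h t b != 0 -> T b.

(** Keep only the terms with index in T of the expansion of x over the dual basis.
Closedness makes this the identity on T, since the expansion of an element of T has
no other terms; so the span of T is a direct summand. *)
Lemma coordinate_projection (T : set P) : coordinate_closed T ->
  exists phi : {linear P -> P},
    (forall x, mod_span T (phi x)) /\ (forall x, mod_span T x -> phi x = x).
Proof.
move=> Tcl.
have /dep_choice[u uE] : forall b : P, exists u : {linear R^o -> P},
    forall a, u a = (a : R) *: b.
  move=> b; apply: (@exists_linear R R^o P (fun a => (a : R) *: b)) => a x y.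
  by rewrite scalerDl scalerA.
pose v b : {linear R^o -> P} := if `[< T b >] then u b else \0.
have [g gE] := exists_linear (dsum_lift_linear v).
exists (g \o h); split=> [x|].
  rewrite /= gE; apply: (dsum_lift_submodule (span_submodule T)) => b.
  have [S0 Sl] := span_submodule T.
  rewrite /v; case: asboolP => [Tb|_] //.
  by rewrite uE -[_ *: b]addr0; apply: Sl => //; apply: sub_span.
move=> x; apply: (span_sub (fixed_submodule (g \o h) idfun)) => t Tt.
rewrite /= gE -[RHS](hP uE); apply: eq_dsum_lift => b.
rewrite /v; case: asboolP => // nTb.
suff -> : h t b = 0 by rewrite !linear0.
by apply/eqP; case: eqP => // /eqP /(Tcl _ _ Tt).
Qed.

(** Each element has finitely many nonzero coordinates, so closing up takes
countably many finite steps. *)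
Lemma coordinate_closure (b : P) :
  exists T : set P, [/\ countable T, T b & coordinate_closed T].
Proof.
pose S := fix S n : set P :=
  if n is m.+1 then (\bigcup_(t in S m) [set c | h t c != 0])%classic
  else [set b]%classic.
exists (\bigcup_n S n)%classic; split.
- apply: bigcup_countable => // n _; elim: n => [|n IHn] /=.
    exact/finite_set_countable/finite_set1.
  apply: bigcup_countable => // t _.
  exact/finite_set_countable/dsum_finite.
- by exists 0%N.
- by move=> t c [n _ Snt] tc; exists n.+1 => //; exists t.
Qed.

End Kaplansky.

Lemma exists_well_order (T : eqType) : exists r : rel T,
  [/\ total r, transitive r, antisymmetric r
    & forall (A : set T) b, A b -> exists m, A m /\ forall c, A c -> r m c].
Proof.
have [r rwo] := well_ordering_principle T; exists r.
have rmin (A : set T) b : A b -> exists m, A m /\ forall c, A c -> r m c.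
  move=> Ab; have [|m [[/asboolP Am lm] _]] := rwo (fun x => `[< A x >]).
    by exists b; apply/asboolP.
  by exists m; split=> // c Ac; apply: lm; apply/asboolP.
have rchain : wo_chain r predT by move=> A _; apply: rwo.
have rtot : total r by move=> x y; apply: (wo_chainW rchain).
have ranti : antisymmetric r by move=> x y; apply: (wo_chain_antisymmetric rchain).
split=> // y x z xy yz.
have [|m [m3 lm]] := @rmin [set w | [\/ w = x, w = y | w = z]]%classic x; first exact: Or31.
have [[lx ly] lz] := (lm x (Or31 _ _ erefl), lm y (Or32 _ _ erefl), lm z (Or33 _ _ erefl)).
case: m3 lx ly lz => -> lx ly lz //.
  by have -> : x = y by apply: ranti; rewrite xy lx.
by have <- : y = z by apply: ranti; rewrite yz ly.
Qed.

(** Well-order P and let b run through it, adjoining to the closed set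
already obtained a countable closed set that contains b. The span of the set below
b is a direct summand, with projection phi b, of the span of the set up to b; the
kernel of phi b there is the slice added at stage b, and the differences
c - phi b c, for c in the countable set, generate it. The slices are independent
because phi m kills the slice at m and fixes all earlier ones; they span P by
transfinite induction. *)
Theorem kaplansky (R : pzRingType) (P : lmodType R) : projective P ->
  exists N : P -> lmodType R,
    (forall b, countably_generated (N b)) /\ mod_isomorphic P (dsum N).
Proof.
move=> /projective_dual_basis[h hP].
have [r [rtot rtrans ranti rmin]] := exists_well_order P.
have [C CP] : exists C : P -> set P, forall b,
    [/\ countable (C b), C b b & coordinate_closed h (C b)].
  exact: (dep_choice (coordinate_closure h)).
pose lt b c := r b c /\ b <> c.
pose below b : set P := (\bigcup_(c in [set c | lt c b]) C c)%classic.
have below_closed b : coordinate_closed h (below b).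
  move=> t c [d dlt Cdt] tc; exists d => //.
  by have [_ _] := CP d; apply; [exact: Cdt | ].
have [phi phiP] : exists phi : P -> {linear P -> P}, forall b,
    (forall x, mod_span (below b) (phi b x)) /\
    (forall x, mod_span (below b) x -> phi b x = x).
  apply: (@dep_choice P (fun _ => {linear P -> P}) (fun b f =>
    (forall x, mod_span (below b) (f x)) /\ (forall x, mod_span (below b) x -> f x = x))).
  by move=> b; apply: (coordinate_projection hP (@below_closed b)).
pose upto b := (below b `|` C b)%classic.
have ltW c b : lt c b -> (upto c `<=` below b)%classic.
  move=> ltcb x [[d [rdc ndc] Cdx]|Ccx]; last by exists c.
  exists d => //; have [rcb ncb] := ltcb; split; first exact: rtrans rcb.
  by move=> db; apply: ndc; apply: ranti; rewrite rdc db rcb.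
have span_below b : (mod_span (below b) `<=` mod_span (upto b))%classic.
  by apply: (span_sub (span_submodule _)) => x xb; apply: sub_span; left.
pose slice b := [set x | mod_span (upto b) x /\ phi b x = 0]%classic.
have slice_span b : slice b = mod_span ((fun c => c - phi b c) @` C b)%classic.
  apply/seteqP; split=> [x [xb phix]|].
    have /exists_linear[g gE] : linear (fun x : P => x - phi b x).
      by move=> a y z; rewrite linearP scalerBr opprD addrACA.
    have -> : x = g x by rewrite gE phix subr0.
    move: x xb {phix}.
    apply: (span_sub (preimage_submodule g (span_submodule _))).
    move=> x [xb|Cx] /=; rewrite gE; last by apply: sub_span; exists x.
    have [_ ->] := phiP b; last exact: sub_span.
    by rewrite subrr; case: (span_submodule ((fun c => c - phi b c) @` C b)%classic).
  have [phib phi_id] := phiP b.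
  have slice_sub : is_submodule (slice b).
    split=> [|a u v [ub phiu] [vb phiv]].
      by split; [case: (span_submodule (upto b)) | rewrite linear0].
    split; last by rewrite linearP phiu phiv scaler0 addr0.
    by case: (span_submodule (upto b)) => _; apply.
  apply: (span_sub slice_sub) => _ [c Cc <-].
  split; last by rewrite linearB (phi_id _ (phib c)) subrr.
  apply: (submoduleB (span_submodule _)); last exact: span_below (phib c).
  by apply: sub_span; right.
have /dep_choice[N /dep_choice[iota iotaP]] : forall b, exists N : lmodType R,
    exists i : {linear N -> P}, injective i /\ range i = slice b.
  move=> b; apply: submodule_module; rewrite slice_span; exact: span_submodule.
exists N; split=> [b|].
  have [inj rg] := iotaP b; have [Cc _ _] := CP b.
  apply: (countably_generated_submodule inj); first by rewrite rg slice_span.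
  exact: card_le_trans (card_image_le _ _) Cc.
apply: mod_isomorphic_sym.
have iota_slice b m : slice b (iota b m).
  by have [_ <-] := iotaP b; exists m.
have [sigma sigmaE] := exists_linear (dsum_lift_linear iota).
apply: (linear_bij_isomorphic (dsum_lift_linear iota)) => [x y|y].
  rewrite -!sigmaE => xy; apply/eqP; rewrite -subr_eq0; apply/eqP.
  have: sigma (x - y) = 0 by rewrite linearB xy subrr.
  move: (x - y) => {xy}x sx; have [s [us xs]] := dsum_support x.
  (* The last index at which x is nonzero. *)
  have [[m [ms mmax]]|s0] : (exists m, m \in s /\ forall c, c \in s -> r c m) \/ s = [::].
    elim: s {us xs} => [|c s [[m [ms mmax]]|->]]; first by right.
    - left; have [cm|mc] := orP (rtot c m).
        by exists m; rewrite inE ms orbT; split=> // d /predU1P[->|/mmax].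
      exists c; rewrite inE eqxx; split=> // d /predU1P[->|/mmax dm].
        by have := rtot c c; rewrite orbb.
      exact: rtrans dm mc.
    - left; exists c; rewrite inE eqxx; split=> // d /[!inE] /eqP ->.
      by have := rtot c c; rewrite orbb.
  2: by apply: dsum_ext => i; apply/eqP; rewrite -[_ == _]negbK -xs s0.
  have [_ phi_id] := phiP m; have [_ phim] := iota_slice m (x m).
  have xm0 : iota m (x m) = 0.
    have := sx; rewrite sigmaE (@dsum_liftE _ _ _ _ iota s) // => [|i]; last by rewrite xs.
    rewrite (bigD1_seq m) //= => /(canRL (addrK _)); rewrite sub0r.
    set rest := \sum_(i <- s | _) _ => restE.
    have : phi m rest = rest.
      apply: phi_id; rewrite /rest -big_filter.
      apply: (submodule_sum (span_submodule _)) => b; rewrite mem_filter => /andP[bm bs].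
      have [ub _] := iota_slice b (x b).
      have bltm : lt b m by split; [apply: mmax | apply/eqP].
      move: ub; apply: (span_sub (span_submodule _)) => z zb.
      exact: sub_span (ltW _ _ bltm _ zb).
    have -> : rest = - iota m (x m) by rewrite restE opprK.
    by rewrite linearN phim oppr0 => /esym/eqP; rewrite oppr_eq0 => /eqP.
  have [iinj _] := iotaP m; move: ms; rewrite xs => /negP[]; apply/eqP.
  by apply: iinj; rewrite xm0 linear0.
suff uptoS b : (upto b `<=` range sigma)%classic.
  have [|x _ <-] := uptoS y y; first by right; have [] := CP y.
  by exists x; rewrite sigmaE.
apply: contrapT => nb.
(* Transfinite induction, through a least stage at which the claim fails. *)
have [m [nm mmin]] := rmin [set b | ~ (upto b `<=` range sigma)]%classic b nb.
have lower : (below m `<=` range sigma)%classic.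
  move=> x [c [rcm ncm] Ccx]; have [cS|/mmin rmc] := pselect (upto c `<=` range sigma)%classic.
    by apply: cS; right.
  by case: ncm; apply: ranti; rewrite rcm rmc.
apply: nm => x mx; have [phim phi_id] := phiP m.
rewrite -[x](subrK (phi m x)); apply: (submoduleD (range_submodule _)).
  have : slice m (x - phi m x).
    split; last by rewrite linearB (phi_id _ (phim x)) subrr.
    apply: (submoduleB (span_submodule _)); first exact: sub_span.
    exact: span_below (phim x).
  have [_ <-] := iotaP m => -[z _ <-]; exists (dsum_in z) => //.
  by rewrite sigmaE dsum_lift_in.
exact: (span_sub (range_submodule _) lower (phim x)).
Qed.

(** * Retracts *)

Section Retracts.
Variable R : pzRingType.
Implicit Types M N P Q : lmodType R.

Definition retract M N : Prop :=
  exists (i : {linear M -> N}) (r : {linear N -> M}), cancel i r.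

Lemma isomorphic_retract M N : mod_isomorphic M N -> retract M N.
Proof.
move=> MN; have [g [f gK fK]] := mod_isomorphic_sym MN.
have [f' f'E] : exists f' : {linear M -> N}, f' =1 f.
  by apply: exists_linear => a u v; apply: (can_inj gK); rewrite linearP !fK.
by exists f', g => x; rewrite f'E fK.
Qed.

Lemma retract_trans N M P : retract M N -> retract N P -> retract M P.
Proof.
move=> [i [r ir]] [j [s js]]; exists (j \o i), (r \o s) => x /=.
by rewrite js ir.
Qed.

Lemma retract_surjective M N (i : {linear M -> N}) (r : {linear N -> M}) :
  cancel i r -> forall y, exists x, r x = y.
Proof. by move=> ir y; exists (i y). Qed.

Lemma finitely_generated_retract M N :
  retract M N -> finitely_generated N -> finitely_generated M.
Proof. by move=> [i [r /retract_surjective]]; apply: finitely_generated_image. Qed.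

Lemma countably_generated_retract M N :
  retract M N -> countably_generated N -> countably_generated M.
Proof. by move=> [i [r /retract_surjective]]; apply: countably_generated_image. Qed.

Lemma projective_retract M N : retract M N -> projective N -> projective M.
Proof.
move=> [i [r ir]] Nproj A B g f gs.
have [h hE] := Nproj A B g (f \o r) gs.
by exists (h \o i) => x /=; rewrite hE /= ir.
Qed.

Lemma retract_dsum (I : choiceType) (F : I -> lmodType R) i : retract (F i) (dsum F).
Proof.
have [u uE] := @dsum_coprojection R I F i; have [p pE] := @dsum_projection R I F i.
by exists u, p => m; rewrite uE pE dsum_in_id.
Qed.

(** The complement is the kernel of the retraction. The conclusion speaks of a
whole sequence of modules, zero from the second index on, because countable sums
are the only ones that an aleph0-monoid has. *)
Lemma retract_complement P Q : retract P Q ->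
  exists K, retract K Q /\
    forall F : nat -> lmodType R, F 0%N = P -> F 1%N = K ->
      (forall n (x : F n.+2), x = 0) -> mod_isomorphic Q (dsum F).
Proof.
move=> [i [r ir]].
have [K [k [kinj krg]]] := submodule_module (fixed_submodule r \0).
have rk y : r (k y) = 0 by have : range k (k y) by []; rewrite krg.
have /dep_choice[q0 q0E] : forall x, exists y, k y = x - i (r x).
  move=> x; have : [set x | r x = (\0 : {linear Q -> P}) x]%classic (x - i (r x)).
    by rewrite /= linearB ir subrr.
  by rewrite -krg => -[y _ <-]; exists y.
have [q qE] : exists q : {linear Q -> K}, q =1 q0.
  apply: exists_linear => a x y; apply: kinj.
  by rewrite (linearP k) !q0E (linearP r) (linearP i) scalerBr opprD addrACA.
have kq x : k (q x) = x - i (r x) by rewrite qE q0E.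
exists K; split.
  by exists k, q => y; apply: kinj; rewrite kq rk linear0 subr0.
move=> F F0 F1 F2; move: F0 F1 i r ir k kinj krg rk {q0 q0E} q {qE} kq => <- <-.
move=> i r ir k kinj _ rk q kq.
pose p n : {linear Q -> F n} :=
  match n return {linear Q -> F n} with 0 => r | 1 => q | _ => \0 end.
apply: (@dsum_recognition R nat F Q p) => [x|x px|n m].
- apply: (@sub_finite_set _ _ `I_2 _ (finite_II 2)) => -[|[|n]] //=.
  by rewrite eqxx.
- have r0 : r x = 0 := px 0%N; have q0 : q x = 0 := px 1%N.
  by have := kq x; rewrite r0 q0 (linear0 k) (linear0 i) subr0.
- case: n m => [|[|n]] m.
  + exists (i m); split; first exact: ir.
    by case=> [|[|j]] // _; apply: kinj; rewrite kq ir subrr linear0.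
  + exists (k m); split; last by case=> [|[|j]] // _; exact: rk.
    by apply: kinj; rewrite kq rk (linear0 i) subr0.
  + by exists 0; split=> [|j _]; [rewrite [RHS]F2 linear0 | rewrite linear0].
Qed.

(** Finitely many generators of P have finitely many nonzero coordinates in all,
hence P lives in finitely many coordinates. Allowing any G with F as a retract
below n covers the truncated sequences, whose terms are isomorphic to those of F
without being the same modules. *)
Lemma retract_truncation (F : nat -> lmodType R) P :
  finitely_generated P -> retract P (dsum F) ->
  exists n, forall G : nat -> lmodType R,
    (forall j, (j < n)%N -> retract (F j) (G j)) -> retract P (dsum G).
Proof.
move=> [X [/finite_seqP[s ->] Xgen]] [i [r ir]].
have /dep_choice[b bE] := fun x : P => dsum_bound (i x).
pose n := (\max_(x <- s) b x)%N.
have ni x : forall j, (n <= j)%N -> i x j = 0.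
  have : (mod_span [set` s]%classic) x by rewrite /mod_span Xgen.
  move: x; apply: span_sub.
    split=> [|a u v iu iv] /= j nj; first by rewrite linear0.
    by rewrite linearP dsumDE dsumZE iu // iv // scaler0 addr0.
  move=> x /= xs j nj; apply: bE; apply: leq_trans nj.
  exact: leq_bigmax_seq.
exists n => G FG.
have [tr trE] : exists tr : forall j, {linear F j -> G j} * {linear G j -> F j},
    forall j, (j < n)%N -> cancel (tr j).1 (tr j).2.
  apply: (@dep_choice nat (fun j => ({linear F j -> G j} * {linear G j -> F j})%type)
    (fun j f => (j < n)%N -> cancel f.1 f.2)) => j.
  have [jn|jn] := ltnP j n; last by exists (\0 : {linear _ -> _}, \0 : {linear _ -> _}).
  by have [t [u tu]] := FG j jn; exists (t, u).
have [t tE] := @dsum_map R nat F G (fun j => (tr j).1).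
have [u uE] := @dsum_map R nat G F (fun j => (tr j).2).
exists (t \o i), (r \o u) => x /=; rewrite -[RHS]ir; congr (r _).
apply: dsum_ext => j; rewrite uE tE.
by have [jn|nj] := ltnP j n; [rewrite trE | rewrite ni // !linear0].
Qed.

Lemma finitely_generated_dsum (F : nat -> lmodType R) n :
  (forall i, (i < n)%N -> finitely_generated (F i)) ->
  (forall i, (n <= i)%N -> forall x : F i, x = 0) -> finitely_generated (dsum F).
Proof.
move=> Ffg F0.
have Ffg' i : finitely_generated (F i).
  have [/Ffg //|/F0 Fi0] := ltnP i n; exists set0; split; first exact: finite_set0.
  by apply/seteqP; split=> // x _ A [[A0 _] _]; rewrite (Fi0 x).
have /dep_choice[X XP] := Ffg'.
exists (\bigcup_(i in `I_n) (@dsum_in R nat F i @` X i))%classic; split.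
  by apply: bigcup_finite => // i _; have [Xfin _] := XP i; apply: finite_image.
apply/seteqP; split=> // x _ A [Asub XA].
move: x; apply: (dsum_submodule Asub) => i m.
have [iin|/F0 Fi0] := ltnP i n; last first.
  have [u uE] := @dsum_coprojection R nat F i.
  by rewrite (Fi0 m) -uE linear0; case: Asub.
have [u uE] := @dsum_coprojection R nat F i; rewrite -uE.
have [_ Xgen] := XP i; have : mod_span (X i) m by rewrite /mod_span Xgen.
apply: (span_sub (preimage_submodule u Asub)) => z Xz /=; rewrite uE.
by apply: XA; exists i => //; exists z.
Qed.

Lemma countable_sequence (T : Type) (x0 : T) (X : set T) :
  countable X -> exists e : nat -> T, (X `<=` range e)%classic.
Proof.
move=> /countable_injP[f finj].
have /dep_choice[e eE] : forall n, exists x, forall y, X y -> f y = n -> x = y.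
  move=> n; have [[y [Xy yn]]|none] := pselect (exists y, X y /\ f y = n).
    exists y => z Xz zn; apply: finj; rewrite ?inE //; exact: etrans yn (esym zn).
  by exists x0 => y Xy yn; case: none; exists y.
by exists e => x Xx; exists (f x) => //; apply: eE.
Qed.

Lemma countably_generated_projective_retract P :
  projective P -> countably_generated P ->
  retract P (dsum (fun _ : nat => R^o : lmodType R)).
Proof.
move=> Pproj [X [/(countable_sequence (0 : P))[e Xe] Xgen]].
have /dep_choice[u uE] : forall n, exists u : {linear R^o -> P},
    forall a, u a = (a : R) *: e n.
  move=> n; apply: (@exists_linear R R^o P (fun a => (a : R) *: e n)) => a x y.
  by rewrite scalerDl scalerA.
have [g gE] := exists_linear (dsum_lift_linear u).
have [|h hE] := Pproj _ _ g idfun; last by exists h, g => x; rewrite hE.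
suff gs : forall y, range g y by move=> y; have [x _ <-] := gs y; exists x.
move=> y; have : mod_span X y by rewrite /mod_span Xgen.
apply: (span_sub (range_submodule g)) => _ /Xe[n _ <-].
exists (@dsum_in R nat (fun _ => R^o) n 1) => //.
by rewrite gE dsum_lift_in uE scale1r.
Qed.

Lemma finitely_generated_regular : finitely_generated (R^o : lmodType R).
Proof.
exists [set (1 : R)]%classic; split; first exact: finite_set1.
apply/seteqP; split=> // x _ A [[A0 Al] A1].
by rewrite -[x]addr0 -[x]mulr1; apply: (Al x 1 0) => //; apply: A1.
Qed.

Lemma projective_regular : projective (R^o : lmodType R).
Proof.
move=> A B g f gs; have [a aE] := gs (f 1).
have [h hE] : exists h : {linear R^o -> A}, forall x, h x = (x : R) *: a.
  apply: (@exists_linear R R^o A (fun x => (x : R) *: a)) => c x y.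
  by rewrite scalerDl scalerA.
by exists h => x; rewrite hE linearZ aE -linearZ /= [_ *: _]mulr1.
Qed.

(** Countably many generators have countably many nonzero coordinates in all, so
every other summand vanishes. Numbering the rest by an injection e, the n-th module
G n is the summand F i with e i = n, or zero if n is not a value of e. *)
Lemma countable_decomposition (I : choiceType) (F : I -> lmodType R) P :
  countably_generated P -> (forall i, finitely_generated (F i)) ->
  mod_isomorphic P (dsum F) ->
  exists G : nat -> lmodType R,
    (forall n, finitely_generated (G n)) /\ mod_isomorphic P (dsum G).
Proof.
move=> Pcg Ffg PF.
have [X [Xc Xgen]] : countably_generated (dsum F).
  have [r [i ri]] := isomorphic_retract (mod_isomorphic_sym PF).
  exact: (countably_generated_image (retract_surjective ri)).
pose J := (\bigcup_(x in X) [set i | x i != 0])%classic.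
have Jc : countable J.
  by apply: bigcup_countable => // x _; apply/finite_set_countable/dsum_finite.
have J0 (x : dsum F) i : ~ J i -> x i = 0.
  move=> nJi; have : mod_span X x by rewrite /mod_span Xgen.
  have [p pE] := @dsum_projection R I F i; rewrite -pE.
  apply: (span_sub (fixed_submodule p \0)) => y Xy /=; rewrite pE.
  by apply/eqP; apply: contrapT => /negP yi; apply: nJi; exists y.
have [e einj] := countable_injP _ Jc.
(* Specification of the n-th module and of the coordinate function onto it, both
   chosen at once so that no transport along e i = n is needed. *)
pose good n (Gp : {G : lmodType R & {linear dsum F -> G}}) :=
  let p := projT2 Gp in
  [/\ finitely_generated (projT1 Gp),
      forall x, p x != 0 -> exists i, [/\ J i, e i = n & x i != 0],
      forall i, J i -> e i = n -> forall x, p x = 0 -> x i = 0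
    & forall m, exists x : dsum F, p x = m /\ forall j, e j <> n -> x j = 0].
have [Gp GpP] : exists Gp : nat -> {G : lmodType R & {linear dsum F -> G}},
    forall n, good n (Gp n).
  apply: (dep_choice (P := good)) => n.
  have [[i [Ji ein]]|none] := pselect (exists i, J i /\ e i = n).
    have [p pE] := @dsum_projection R I F i; exists (existT _ (F i) p).
    split=> /=; first exact: Ffg.
    - by move=> x px; exists i; split; rewrite // -pE.
    - move=> j Jj ejn x; rewrite pE; suff -> : j = i by [].
      by apply: einj; rewrite ?inE // ejn ein.
    - move=> m; exists (dsum_in m); rewrite pE dsum_in_id; split=> // j ejn.
      by rewrite dsum_in_neq //; apply/eqP => ij; apply: ejn; rewrite -ij.
  exists (existT _ ('rV[R]_0 : lmodType R) (\0 : {linear dsum F -> 'rV[R]_0})); split=> /=.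
  - exists set0; split; first exact: finite_set0.
    by apply/seteqP; split=> // x _ A [[A0 _] _]; rewrite thinmx0.
  - by move=> x; rewrite eqxx.
  - by move=> i Ji ein; case: none; exists i.
  - by move=> m; exists 0; split=> //; rewrite [LHS]thinmx0 [RHS]thinmx0.
exists (fun n => projT1 (Gp n)); split; first by move=> n; case: (GpP n).
apply: (mod_isomorphic_trans PF).
apply: (dsum_recognition (p := fun n => projT2 (Gp n))) => [x|x px|n m].
- apply: (sub_finite_set _ (finite_image e (dsum_finite x))) => n /= pn.
  by have [_ /(_ x pn)[i [_ ein xi]] _ _] := GpP n; exists i.
- apply: dsum_ext => i; have [Ji|/J0 -> //] := pselect (J i).
  by have [_ _ /(_ i Ji erefl x (px _))] := GpP (e i).
- have [_ _ _ /(_ m)[x [xm x0]]] := GpP n; exists x; split=> // j nj.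
  have [_ pj _ _] := GpP j; apply/eqP; apply: contrapT => /negP /pj[i [Ji eij]].
  by move/eqP; apply; apply: x0 => ein; move: nj; rewrite -ein eij eqxx.
Qed.

Lemma dsum_sigma (I J : choiceType) (F : I -> J -> lmodType R) :
  mod_isomorphic (dsum (fun i => dsum (F i)))
                 (dsum (fun k : I * J => F k.1 k.2)).
Proof.
have [p pE] : exists p : forall k : I * J, {linear dsum (fun i => dsum (F i)) -> F k.1 k.2},
    forall k x, p k x = x k.1 k.2.
  apply: (@dep_choice (I * J) (fun k => {linear dsum (fun i => dsum (F i)) -> F k.1 k.2})
    (fun k f => forall x, f x = x k.1 k.2)) => k.
  by apply: (@exists_linear R _ _ (fun x : dsum (fun i => dsum (F i)) => x k.1 k.2)).
apply: (dsum_recognition (p := p)) => [x|x px|[i j] m].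
- apply: (@sub_finite_set _ _ (\bigcup_(i in [set i | x i != 0%R])
     (pair i @` [set j | x i j != 0%R]))%classic).
    move=> [i j] /=; rewrite pE /= => xij; exists i => /=; last by exists j.
    by apply: contra_neq xij => ->.
  apply: bigcup_finite => [|i _]; first exact: dsum_finite.
  exact: (finite_image _ (dsum_finite (x i))).
- apply: dsum_ext => i; apply: dsum_ext => j.
  by have := px (i, j); rewrite pE.
- pose y := @dsum_in R I (fun i => dsum (F i)) i (@dsum_in R J (F i) j m).
  have yi : y i = dsum_in m := dsum_in_id _.
  exists y; split=> [|[i' j'] ij]; rewrite pE.
    by rewrite -[RHS](dsum_in_id m) -yi.
  change (y i' j' = 0); have [ii|ii] := eqVneq i i'; last by rewrite /y dsum_in_neq.
  case: _ / ii ij => ij; rewrite yi dsum_in_neq //.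
  by apply: contra_neq ij => /= ->.
Qed.

End Retracts.

(** * Compact elements of an aleph0-monoid *)

Section Compact.
Variable H : aleph0Monoid.
Implicit Types x y : H.

Definition summand x y : Prop := exists z : nat -> H, z 0%N = x /\ asum z = y.

Definition truncation (z : nat -> H) n : nat -> H :=
  fun i => if (i < n)%N then z i else azero.

Definition compact x : Prop := forall z : nat -> H,
  summand x (asum z) -> exists n, summand x (asum (truncation z n)).

Definition compactly_generated : Prop :=
  forall y, exists x : nat -> H, (forall i, compact (x i)) /\ asum x = y.

End Compact.

Lemma isomorphic_compactly_generated (H K : aleph0Monoid) :
  aleph0_isomorphic H K -> compactly_generated H <-> compactly_generated K.
Proof.
have half (A B : aleph0Monoid) : aleph0_isomorphic A B ->
    compactly_generated A -> compactly_generated B.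
  move=> [f [[g fK gK] f0 fS]] Acg y.
  have gS (z : nat -> B) : g (asum z) = asum (fun i => g (z i)).
    apply: (can_inj fK); rewrite gK fS; congr asum.
    by apply/funext => i; rewrite gK.
  have f_summand a b : summand a b -> summand (f a) (f b).
    by move=> [z [<- <-]]; exists (fun i => f (z i)); rewrite fS.
  have g_summand a b : summand a b -> summand (g a) (g b).
    by move=> [z [<- <-]]; exists (fun i => g (z i)); rewrite gS.
  have [x [xc xy]] := Acg (g y).
  exists (fun i => f (x i)); split; last by rewrite -fS xy gK.
  move=> i z /g_summand; rewrite fK gS => /xc[n /f_summand].
  rewrite fS => xn; exists n; suff -> : truncation z n =
    (fun j => f (truncation (fun k => g (z k)) n j)) by [].
  by apply/funext => j; rewrite /truncation; case: ifP; rewrite ?gK ?f0.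
move=> HK; split; first exact: half.
apply: half; have [f [[g fK gK] f0 fS]] := HK.
exists g; split; [by exists f | by rewrite -f0 fK |].
move=> z; apply: (can_inj fK); rewrite gK fS; congr asum.
by apply/funext => i; rewrite gK.
Qed.

(** * Compact classes are the finitely generated ones *)

Section VMonoidCompact.
Variable R : pzRingType.
Implicit Types (c d : Vmonoid R) (P Q : cgproj R).

Lemma Vrepr_sum (z : nat -> Vmonoid R) :
  mod_isomorphic (Vrepr (asum z)) (dsum (fun i => Vrepr (z i) : lmodType R^c)).
Proof. exact: Vrepr_class. Qed.

Lemma Vrepr_zero (x : Vrepr (azero : Vmonoid R)) : x = 0.
Proof.
have [f [g fK _]] := Vrepr_class (cgproj_zero R).
by apply: (can_inj fK); rewrite [LHS]thinmx0 [RHS]thinmx0.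
Qed.

Lemma Vclass_sum (P : nat -> cgproj R) :
  asum (fun i => Vclass (P i)) = Vclass (cgproj_dsum P).
Proof. exact: Vsum_class. Qed.

(** A sequence with first term c has sum d when its other terms add up to a
complement of c in d; for a retract, the kernel of the retraction provides one,
which is again projective and countably generated, being a retract of d. *)
Lemma summand_retract c d : summand c d <-> retract (Vrepr c) (Vrepr d).
Proof.
split=> [[z [<- <-]]|cd].
  apply: (retract_trans (N := dsum (fun i => Vrepr (z i) : lmodType R^c))).
    exact: (@retract_dsum R^c nat (fun i => Vrepr (z i)) 0%N).
  exact/isomorphic_retract/mod_isomorphic_sym/Vrepr_sum.
have [K [Kd dK]] := retract_complement cd.
pose K' := CGProj (countably_generated_retract Kd (cgproj_countable _))
  (projective_retract Kd (@cgproj_projective _ _)).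
pose G n : cgproj R :=
  match n with 0 => Vrepr c | 1 => K' | _ => cgproj_zero R end.
exists (fun n => Vclass (G n)); split; first exact: VreprK.
rewrite Vclass_sum -[RHS]VreprK; apply/Vclass_eqP/mod_isomorphic_sym.
by apply: (dK (fun n => G n : lmodType R^c)) => // n x; rewrite [LHS]thinmx0 [RHS]thinmx0.
Qed.

Lemma finitely_generated_compact c : finitely_generated (Vrepr c) -> compact c.
Proof.
move=> cfg z /summand_retract cz.
have [|n nP] := @retract_truncation R^c (fun i => Vrepr (z i)) (Vrepr c) cfg.
  exact: retract_trans cz (isomorphic_retract (Vrepr_sum z)).
exists n; apply/summand_retract.
apply: (retract_trans (N := dsum (fun i => Vrepr (truncation z n i) : lmodType R^c))).
  apply: nP => j jn; rewrite /truncation jn.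
  exact/isomorphic_retract/mod_isomorphic_refl.
exact/isomorphic_retract/mod_isomorphic_sym/Vrepr_sum.
Qed.

(** A countably generated projective module splits off from a countable sum of
copies of the regular module U. Compactness cuts this sum down to finitely many
copies. *)
Lemma compact_finitely_generated c : compact c -> finitely_generated (Vrepr c).
Proof.
pose U : cgproj R := CGProj
  (finite_countably_generated (@finitely_generated_regular R^c))
  (@projective_regular R^c).
have Ufg : finitely_generated (Vrepr (Vclass U)).
  apply: finitely_generated_retract (@finitely_generated_regular R^c).
  exact/isomorphic_retract/Vrepr_class.
move=> cc; have [|n] := cc (fun _ => Vclass U).
  apply/summand_retract.
  apply: (retract_trans (N := dsum (fun _ : nat => (R^c)^o : lmodType R^c))).
    apply: countably_generated_projective_retract.
      exact: cgproj_projective.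
    exact: cgproj_countable.
  apply/isomorphic_retract/mod_isomorphic_sym.
  apply: mod_isomorphic_trans (Vrepr_sum _) _.
  by apply: dsum_isomorphic => i; apply: Vrepr_class.
move=> /summand_retract/finitely_generated_retract; apply.
apply: finitely_generated_retract (isomorphic_retract (Vrepr_sum _)) _.
apply: (@finitely_generated_dsum _ _ n) => i; rewrite /truncation.
  by move=> ->.
by rewrite ltnNge => ->; apply: Vrepr_zero.
Qed.

(** Compactness is used both ways here: the finitely generated summands of a
decomposition give compact classes, and a sum of compact classes is realized by
finitely generated representatives. In the second case the pieces of a Kaplansky
decomposition are split further, and the double direct sum is regrouped. *)
Lemma pdfg_compactly_generated : pdfg R <-> compactly_generated (Vmonoid R).
Proof.
split=> [Rpdfg c|cg P Pproj].
  have [I [F [Ffg cF]]] := Rpdfg (Vrepr c) (@cgproj_projective R (Vrepr c)).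
  have [G [Gfg cG]] := @countable_decomposition R^c {classic I} F (Vrepr c)
    (@cgproj_countable R (Vrepr c)) Ffg cF.
  have Gproj n : projective (G n).
    apply: projective_retract (@cgproj_projective R (Vrepr c)).
    apply: retract_trans (@retract_dsum R^c nat G n) _.
    exact/isomorphic_retract/mod_isomorphic_sym.
  pose G' n : cgproj R := CGProj (finite_countably_generated (Gfg n)) (Gproj n).
  exists (fun n => Vclass (G' n)); split=> [n|].
    apply: finitely_generated_compact.
    exact: finitely_generated_retract (isomorphic_retract (Vrepr_class (G' n))) (Gfg n).
  by rewrite Vclass_sum -[RHS]VreprK; apply/Vclass_eqP/mod_isomorphic_sym.
have [N [Ncg PN]] := kaplansky Pproj.
have Nproj b : projective (N b).
  apply: projective_retract Pproj.
  apply: retract_trans (@retract_dsum R^c P N b) _.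
  exact/isomorphic_retract/mod_isomorphic_sym.
pose N' b : cgproj R := CGProj (Ncg b) (Nproj b).
have /dep_choice[x xP] := fun b => cg (Vclass (N' b)).
exists (P * nat)%type, (fun k => Vrepr (x k.1 k.2) : lmodType R^c); split=> [k|].
  by apply: compact_finitely_generated; have [] := xP k.1.
apply: mod_isomorphic_trans PN _.
apply: mod_isomorphic_trans (@dsum_sigma R^c P nat (fun b n => Vrepr (x b n))).
apply: dsum_isomorphic => b; have [_ xb] := xP b.
apply: mod_isomorphic_trans (Vrepr_sum (x b)); rewrite xb.
exact: mod_isomorphic_sym (Vrepr_class (N' b)).
Qed.

End VMonoidCompact.

Theorem lemma3p2 (H : aleph0Monoid) :
  ~ aleph0_cyclic H -> aleph0_two_generated H ->
  ~ (exists R S : pzRingType,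
       [/\ pdfg R, ~ pdfg S,
           aleph0_isomorphic H (Vmonoid R)
         & aleph0_isomorphic H (Vmonoid S)]).
Proof.
move=> _ _ [R [S [Rpdfg Spdfg HR HS]]]; apply/Spdfg/pdfg_compactly_generated.
apply/(isomorphic_compactly_generated HS)/(isomorphic_compactly_generated HR).
exact/pdfg_compactly_generated.
Qed.
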